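(* Let $0<s<\tfrac12$ and set $$\gamma(s)=\gamma_1(s)\gamma_2(s),\qquad \gamma_1(s)=\frac{1}{2}\left(\frac{2^{1-2s}-1}{1-2^{-2s}}\right),\qquad \gamma_2(s)=\frac{2-2^{-2s}}{1-2^{-2s}}.$$ Then for every $\varphi\in\mathcal{S}(\mathcal{H})$, $$\mathcal{Q}^\delta_s(\varphi)\cdot\mathcal{E}^\delta_s(\varphi)\geq\gamma(s)\,\|\varphi\|_{L^2(\mathbb{R}^+)}^4 .$$
   Context: Let $\mathbb{R}^+=(0,\infty)$. Dyadic intervals. $\mathcal{D}$ is the family of dyadic intervals in $\mathbb{R}^+$, namely the intervals $I^j_k=(k2^{-j},(k+1)2^{-j}]$ with $j\in\mathbb{Z}$ and $k$ a nonnegative integer. Dyadic distance. For $x,y\in\mathbb{R}^+$ set $\delta(x,y)=\inf\{|I|: I\in\mathcal{D},\ x,y\in I\}$. This is a metric on $\mathbb{R}^+$. Haar system. Let $h=\chi_{(0,1/2]}-\chi_{(1/2,1]}$. The Haar system $\mathcal{H}$ consists of the functions $h_I(x)=2^{j/2}h(2^jx-k)$, one for each $I=I^j_k\in\mathcal{D}$. For $h=h_I$ write $I(h)=I$. The system $\mathcal{H}$ is an orthonormal basis of $L^2(\mathbb{R}^+)$. $\mathcal{S}(\mathcal{H})$ denotes the set of finite linear combinations (complex coefficients) of elements of $\mathcal{H}$. Quadratic forms, for functions on $\mathbb{R}^+$: $$\mathcal{E}^\delta_s(\varphi)=\iint_{(\mathbb{R}^+)^2}\frac{|\varphi(x)-\varphi(y)|^2}{\delta(x,y)^{2s}}\,\frac{dx\,dy}{\delta(x,y)},$$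 $$\mathcal{Q}^\delta_s(\varphi)=\iint_{(\mathbb{R}^+)^2}\delta(x,y)^{2s}\varphi(x)\overline{\varphi(y)}\,\frac{dx\,dy}{\delta(x,y)}.$$ *)

(* Defs.v *)
From HB Require Import structures.
From mathcomp Require Import all_boot all_order all_algebra.
From mathcomp Require Import all_classical all_reals all_analysis.
From mathcomp Require Import complex.
Set Implicit Arguments. Unset Strict Implicit. Unset Printing Implicit Defensive.
Import Order.TTheory GRing.Theory Num.Theory.
Import numFieldNormedType.Exports.
Local Open Scope classical_set_scope.
Local Open Scope ring_scope.

Section Dyadic.
Variable R : realType.

Definition dyadic_interval (j : int) (k : nat) : set R :=
  [set x | (k%:R * 2 ^ (- j) < x) && (x <= k.+1%:R * 2 ^ (- j))].

Definition dyadic_length (j : int) : R := 2 ^ (- j).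

Definition dyadic_dist (x y : R) : R :=
  inf [set d : R | exists (j : int) (k : nat),
        d = dyadic_length j /\ dyadic_interval j k x /\ dyadic_interval j k y].

Definition haar_mother (x : R) : R :=
  if (0 < x) && (x <= 2^-1) then 1
  else if (2^-1 < x) && (x <= 1) then -1 else 0.

Definition haar (j : int) (k : nat) (x : R) : R :=
  2 `^ (j%:~R / 2) * haar_mother (2 ^ j * x - k%:R).

Definition haar_span : set (R -> R[i]) :=
  [set phi | exists l : seq (R[i] * (int * nat)),
     phi = fun x => \sum_(p <- l) p.1 * (haar p.2.1 p.2.2 x)%:C%C].

Definition Rpos : set R := [set x | 0 < x].
Definition Rpos2 : set (R * R) := [set p | 0 < p.1 /\ 0 < p.2].

Definition leb2 := (@lebesgue_measure R \x @lebesgue_measure R)%E.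

Definition cintegral2 (f : R * R -> R[i]) : R[i] :=
  Complex (Rintegral leb2 Rpos2 (fun p => complex.Re (f p)))
          (Rintegral leb2 Rpos2 (fun p => complex.Im (f p))).

Definition energy (s : R) (phi : R -> R[i]) : R :=
  Rintegral leb2 Rpos2 (fun p =>
    ComplexField.Normc.normc (phi p.1 - phi p.2) ^+ 2 / dyadic_dist p.1 p.2 `^ (2 * s)
      / dyadic_dist p.1 p.2).

Definition qform (s : R) (phi : R -> R[i]) : R[i] :=
  cintegral2 (fun p =>
    (dyadic_dist p.1 p.2 `^ (2 * s))%:C%C * phi p.1 * conjc (phi p.2)
      * ((dyadic_dist p.1 p.2)^-1)%:C%C).

Definition L2norm (phi : R -> R[i]) : R :=
  Num.sqrt (Rintegral (@lebesgue_measure R) Rpos (fun x => ComplexField.Normc.normc (phi x) ^+ 2)).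

Definition gamma1 (s : R) : R :=
  2^-1 * ((2 `^ (1 - 2 * s) - 1) / (1 - 2 `^ (- (2 * s)))).
Definition gamma2 (s : R) : R :=
  (2 - 2 `^ (- (2 * s))) / (1 - 2 `^ (- (2 * s))).
Definition gamma (s : R) : R := gamma1 s * gamma2 s.

End Dyadic.

(* Main.v *)
(* Write x ~_j y when x and y lie in the same dyadic interval of length 2^-j.  A
   power of delta(x,y) is a telescoping sum over j of weighted indicators of ~_j,
   so with a = 2^(-2s), with P_j the averaging over the dyadic intervals of length
   2^-j, and with A_j = ||P_j phi||^2,
     Q(phi) = (1 - 1/(2a)) sum_j a^j A_j,
     E(phi) = (2 - a) sum_j a^(-j) (||phi||^2 - A_j).
   Here A_j is nondecreasing, vanishes for j small (mean zero) and equals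
   ||phi||^2 for j large (phi is a step function); summation by parts expresses
   both forms through the increments A_(j+1) - A_j >= 0, which are the sums of the
   squared Haar coefficients of one scale, and the inequality is Cauchy-Schwarz. *)
Require Import Defs.
From HB Require Import structures.
From mathcomp Require Import all_boot all_order all_algebra.
From mathcomp Require Import all_classical all_reals all_analysis.
From mathcomp Require Import complex.
From mathcomp Require Import measurable_realfun.
From mathcomp Require Import zify ring lra.
Set Implicit Arguments. Unset Strict Implicit. Unset Printing Implicit Defensive.
Import Order.TTheory GRing.Theory Num.Theory.
Import numFieldNormedType.Exports.
Local Open Scope classical_set_scope.
Local Open Scope ring_scope.

(** * Dyadic cells and the dyadic distance *)

Section DyadicCells.
Context (R : realType).
Implicit Types (j m : int) (k n : nat) (x y : R).

(** The two forms call for different limits. In [qform] the level series runs through infinitely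
    many fine levels, its kernel is not integrable over the whole quadrant, and phi(x) conj(phi(y))
    has no sign. So the kernel is cut to the square (0, 2^M]^2 that carries phi, shown integrable
    there by monotone convergence with phi replaced by 1, and then used as majorant for dominated
    convergence. The energy series has nonnegative terms, so monotone convergence is enough; its
    infinite tail lies at the coarse levels. Each form becomes a sum over the K = M + N levels
    between the support and the resolution of phi, plus a geometric tail. The tails converge because
    a < 1, that is s > 0; the factor 1 - 1/(2a) is positive because a > 1/2, that is s < 1/2. Real
    and imaginary parts of phi are treated as two real functions, and the imaginary part of Q
    cancels by symmetry of the kernel. *)

Definition in_cell j k x : bool := (k%:R * 2 ^ (- j) < x) && (x <= k.+1%:R * 2 ^ (- j)).

(** Cells are closed on the right, hence a ceiling minus one instead of a floor. The absolute value
    makes the result meaningless for x <= 0, which is why positivity is assumed wherever indices are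
    compared. *)
Definition cell_index j x : nat := `|Num.ceil (x * 2 ^ j)|%N.-1.

Lemma exp2_gt0 j : 0 < (2 : R) ^ j.
Proof. by rewrite exprz_gt0. Qed.

Lemma exp2S j : (2 : R) ^ (- j) = 2 * 2 ^ (- (j + 1)).
Proof.
have -> : - j = 1 + - (j + 1) by lia.
by rewrite expfzDr ?pnatr_eq0// expr1z; congr (2 * 2 ^ _); lia.
Qed.

Lemma in_cell_gt0 j k x : in_cell j k x -> 0 < x.
Proof.
by move=> /andP[+ _]; apply: le_lt_trans; rewrite mulr_ge0// ltW// exp2_gt0.
Qed.

Lemma in_cellE j k x : 0 < x -> in_cell j k x = (cell_index j x == k).
Proof.
move=> x0; have e0 := exp2_gt0 j; have t0 : 0 < x * 2 ^ j by rewrite mulr_gt0.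
have -> : in_cell j k x = (Num.ceil (x * 2 ^ j) == k.+1%:Z).
  rewrite ceil_eq /in_cell -!invr_expz ltr_pdivrMr// ler_pdivlMr//.
  by rewrite -[k.+1%:Z%:~R]/(k.+1%:R) (_ : k.+1%:Z - 1 = k%:Z)//; lia.
have c0 : 0 < Num.ceil (x * 2 ^ j) by rewrite ceil_gt0.
by rewrite /cell_index; apply/eqP/eqP; lia.
Qed.

Lemma in_cell_split j k x :
  (in_cell j k x)%:R = (in_cell (j + 1) k.*2 x)%:R + (in_cell (j + 1) k.*2.+1 x)%:R :> R.
Proof.
rewrite /in_cell exp2S; set b := 2 ^ _; have b0 : 0 < b by exact: exp2_gt0.
have e1 n : n.+1%:R = n%:R + 1 :> R by rewrite natr1.
have -> : k.*2%:R * b = 2 * (k%:R * b) by rewrite -muln2 natrM; ring.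
have -> : k%:R * (2 * b) = 2 * (k%:R * b) by ring.
have -> : k.+1%:R * (2 * b) = 2 * (k%:R * b) + 2 * b by rewrite e1; ring.
have -> : k.*2.+1%:R * b = 2 * (k%:R * b) + b by rewrite e1 -muln2 natrM; ring.
have -> : k.*2.+2%:R * b = 2 * (k%:R * b) + 2 * b by rewrite !e1 -muln2 natrM; ring.
move: (k%:R * b) => c {e1}.
have h12 : 2 * c <= 2 * c + b by rewrite lerDl ltW.
have h23 : 2 * c + b <= 2 * c + 2 * b by rewrite lerD2l mulr_natl mulr2n lerDl ltW.
have [h1|h1] := leP x (2 * c).
  by rewrite (le_trans h1 h12) ltNge (le_trans h1 h12)/= addr0.
have [h2|h2] := leP x (2 * c + b); first by rewrite (le_trans h2 h23) addr0.
by rewrite add0r.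
Qed.

Lemma cell_index_half j x : 0 < x -> cell_index j x = (cell_index (j + 1) x)./2.
Proof.
move=> x0; set q := cell_index (j + 1) x.
have hq : in_cell (j + 1) q x by rewrite in_cellE.
apply/eqP; rewrite -in_cellE//.
(* The indicator of the parent cell is the sum of those of its children, and one child is the cell
   [q] containing x. *)
suff : (in_cell j q./2 x)%:R != 0 :> R by case: (in_cell j q./2 x) => //; rewrite eqxx.
rewrite in_cell_split -natrD pnatr_eq0 addn_eq0 negb_and !eqb0 !negbK.
by have [e|e] : q./2.*2 = q \/ q./2.*2.+1 = q by [lia| |]; rewrite e hq ?orbT.
Qed.

Lemma same_cell_le j m x y : 0 < x -> 0 < y -> j <= m ->
  cell_index m x = cell_index m y -> cell_index j x = cell_index j y.
Proof.
move=> x0 y0 jm; have -> : m = j + `|m - j|%N by lia.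
elim: `|m - j|%N => [|n IH]; first by rewrite addr0.
move=> h; apply: IH; rewrite cell_index_half// [RHS]cell_index_half//.
by rewrite -addrA -[_ + 1]PoszD addn1 h.
Qed.

Lemma cell_index_lt j n x : 0 < x -> x <= n%:R * 2 ^ (- j) -> (cell_index j x < n)%N.
Proof.
move=> x0 xn; have : in_cell j (cell_index j x) x by rewrite in_cellE.
move=> /andP[+ _] => /lt_le_trans/(_ xn).
by rewrite ltr_pM2r ?exp2_gt0// ltr_nat.
Qed.

Lemma cell_indexP j x : 0 < x ->
  (cell_index j x)%:R * 2 ^ (- j) < x /\ x <= (cell_index j x).+1%:R * 2 ^ (- j).
Proof.
move=> x0; have : in_cell j (cell_index j x) x by rewrite in_cellE.
by move=> /andP.
Qed.

Lemma exists_exp2_ge x : exists n : nat, x <= 2 ^+ n.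
Proof.
exists (Num.bound `|x|); apply: (le_trans (ler_norm x)).
apply: (le_trans (ltW (archi_boundP (normr_ge0 x)))).
by rewrite -natrX ler_nat ltnW// ltn_expl.
Qed.

Lemma exp2N_nat n : (2 : R) ^ (- n%:Z) = (2 ^+ n)^-1.
Proof. by rewrite -invr_expz. Qed.

(** On the half-line both points lie in some (0, 2^a], so they share a coarse cell; they are apart
    once the cell length is at most |x - y|. By nesting, the levels of common cells form a down-set,
    with maximum m. *)
Lemma separation_level x y : 0 < x -> 0 < y -> x != y ->
  exists m, forall j, (cell_index j x == cell_index j y) = (j <= m).
Proof.
move=> x0 y0 xy.
have [a ha] := exists_exp2_ge (Num.max x y).
have [b hb] := exists_exp2_ge (`|x - y|^-1).
have lo : cell_index (- a%:Z) x = cell_index (- a%:Z) y.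
  have idx0 z : 0 < z -> z <= 2 ^+ a -> cell_index (- a%:Z) z = 0%N.
    move=> z0 za; have : (cell_index (- a%:Z) z < 1)%N; last by lia.
    by apply: cell_index_lt => //; rewrite mul1r opprK.
  by move: ha; rewrite ge_max => /andP[hx hy]; rewrite !idx0.
have hi n : (b <= n)%N -> cell_index n%:Z x != cell_index n%:Z y.
  move=> bn; apply/eqP => e; have := cell_indexP n%:Z x0; have := cell_indexP n%:Z y0.
  rewrite -e exp2N_nat; set k := cell_index _ _.
  rewrite -[k.+1%:R]natr1 mulrDl mul1r => -[h1 h2] [h3 h4].
  have d0 : 0 < `|x - y| by rewrite normr_gt0 subr_eq0.
  have : `|x - y| < (2 ^+ n)^-1 by rewrite ltr_norml; apply/andP; split; lra.
  have n0 : 0 < (2:R) ^+ n by rewrite exprn_gt0.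
  rewrite ltNge => /negP; apply.
  rewrite -[leRHS]invrK lef_pV2 ?posrE ?invr_gt0//.
  by apply: (le_trans hb); rewrite ler_eXn2l// ltr1n.
have ex : exists n, cell_index (- a%:Z + n%:Z) x != cell_index (- a%:Z + n%:Z) y.
  by exists (a + b)%N; rewrite PoszD addrA addNr add0r; apply: hi.
(* The first separating level is not the starting level, by [lo], so its predecessor exists and is
   the m sought. *)
have := ex_minnP ex; case=> -[|q].
  by rewrite addr0 lo eqxx.
move=> hq qmin; exists (- a%:Z + q%:Z) => j; apply/idP/idP => [/eqP e|jm].
  rewrite leNgt; apply/negP => lt; move: hq => /eqP; apply.
  by apply: same_cell_le e => //; lia.
apply/eqP; apply: (same_cell_le x0 y0 jm); apply/eqP/negPn/negP => h.
by have := qmin _ h; rewrite ltnn.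
Qed.

Lemma dyadic_distE x y m : 0 < x -> 0 < y ->
  (forall j, (cell_index j x == cell_index j y) = (j <= m)) ->
  dyadic_dist x y = 2 ^ (- m).
Proof.
move=> x0 y0 hm; apply/eqP; rewrite eq_le; apply/andP; split.
- apply: ge_inf.
    by exists 0 => _ /= [j [k [-> _]]]; rewrite ltW// exp2_gt0.
  exists m, (cell_index m x); split=> //.
  have e : cell_index m x = cell_index m y by apply/eqP; rewrite hm.
  by split; [|rewrite e]; apply/andP; exact: cell_indexP.
- apply: lb_le_inf.
    exists (2 ^ (- m)), m, (cell_index m x); split=> //.
    have e : cell_index m x = cell_index m y by apply/eqP; rewrite hm.
    by split; [|rewrite e]; apply/andP; exact: cell_indexP.
  move=> _ [j [k [-> [hx hy]]]].
  have jm : j <= m.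
    rewrite -hm; move: hx hy; rewrite /dyadic_interval /= -!/(in_cell _ _ _).
    by rewrite !in_cellE// => /eqP-> /eqP->.
  by rewrite /dyadic_length ler_eXz2l ?ltr1n//; lia.
Qed.

(** Stated for any exponent so as to serve both forms: p = 2s gives the ratio 2^(1-2s) for Q, p =
    -2s gives 2^(1+2s) for the energy. *)
Lemma dyadic_kernelE x y m (p : R) : 0 < x -> 0 < y ->
  (forall j, (cell_index j x == cell_index j y) = (j <= m)) ->
  dyadic_dist x y `^ p / dyadic_dist x y = (2 `^ (1 - p)) ^ m.
Proof.
move=> x0 y0 hm; rewrite (dyadic_distE x0 y0 hm).
rewrite -[2 ^ (- m)]powR_intmul// -powRN -powRrM -powRD; last by rewrite pnatr_eq0 implybT.
by rewrite -[RHS]powR_intmul ?powR_ge0// -powRrM; congr (_ `^ _); rewrite mulrNz; ring.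
Qed.

End DyadicCells.

(** * Functions with a prescribed integral *)

Section HasIntegral.
Context d (T : measurableType d) (R : realType) (mu : {measure set T -> \bar R}).
Implicit Types (f g : T -> R) (a b c : R).

(** Integrability is bundled with the value because [Rintegral] alone also returns a number when the
    integral is infinite. *)
Definition has_integral f c : Prop :=
  mu.-integrable setT (EFin \o f) /\ Rintegral mu setT f = c.

Lemma has_integral_meas f c : has_integral f c -> measurable_fun setT f.
Proof. by move=> [/measurable_int/measurable_EFinP]. Qed.

Lemma has_integralE f c : has_integral f c -> (\int[mu]_x (f x)%:E)%E = c%:E.
Proof.
move=> [h <-]; rewrite /Rintegral fineK//; exact: integrable_fin_num h.
Qed.

Lemma has_integral_ext g f c : g =1 f -> has_integral g c -> has_integral f c.
Proof. by move=> /funext ->. Qed.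

Lemma has_integral0 : has_integral (fun=> 0) 0.
Proof.
split; last by rewrite Rintegral_cst// mul0r.
exact: integrable0.
Qed.

Lemma has_integralD f g a b : has_integral f a -> has_integral g b ->
  has_integral (fun x => f x + g x) (a + b).
Proof.
move=> [hf <-] [hg <-]; split; last by rewrite RintegralD.
exact: (integrableD measurableT hf hg).
Qed.

Lemma has_integralZ f a c : has_integral f a -> has_integral (fun x => c * f x) (c * a).
Proof.
move=> [hf <-]; split; last by rewrite RintegralZl.
exact: (integrableZl measurableT c hf).
Qed.

Lemma has_integral_sum n (F : nat -> T -> R) (a : nat -> R) :
  (forall i, has_integral (F i) (a i)) ->
  has_integral (fun x => \sum_(i < n) F i x) (\sum_(i < n) a i).
Proof.
move=> h; elim: n => [|n IH].
  by rewrite big_ord0; apply: has_integral_ext has_integral0 => x; rewrite big_ord0.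
rewrite big_ord_recr; apply: has_integral_ext (has_integralD IH (h n)) => x.
by rewrite big_ord_recr.
Qed.

(** Measurability of [g] is assumed separately since [mu] need not be complete. This is what allows
    the diagonal to be removed from the potential. *)
Lemma has_integral_ae (N : set T) f g c : measurable N -> mu N = 0%E ->
  measurable_fun setT g -> (forall x, ~ N x -> f x = g x) ->
  has_integral f c -> has_integral g c.
Proof.
move=> mN N0 mg fg hf; have mf := has_integral_meas hf.
have ae : ae_eq mu setT (EFin \o f) (EFin \o g).
  exists N; split=> // x /= h; apply: contrapT => /fg e; apply: h => _.
  by rewrite /= e.
have mEf : measurable_fun setT (EFin \o f) by exact/measurable_EFinP.
have mEg : measurable_fun setT (EFin \o g) by exact/measurable_EFinP.
have [/integrableP[_ fi] fc] := hf; split; last first.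
  by rewrite -fc /Rintegral; congr fine; apply: ae_eq_integral => //; apply: ae_eq_sym.
apply/integrableP; split=> //; apply: le_lt_trans fi.
rewrite le_eqVlt; apply/orP; left; apply/eqP; apply: ae_eq_integral => //.
- exact: measurableT_comp.
- exact: measurableT_comp.
- by apply: filterS ae => x h /= _; have /= [->] := h I.
Qed.

Lemma has_integral_monotone (S : nat -> T -> R) f (c : nat -> R) l :
  (forall n, has_integral (S n) (c n)) -> (forall n x, 0 <= S n x) ->
  (forall x, nondecreasing_seq (S^~ x)) -> (forall x, S ^~ x @ \oo --> f x) ->
  c @ \oo --> l -> has_integral f l.
Proof.
move=> hS S0 Snd Sf cl.
have mS n : measurable_fun setT (S n) := has_integral_meas (hS n).
have mf : measurable_fun setT f by apply: measurable_fun_cvg mS _ => x _; exact: Sf.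
have f0 x : 0 <= f x.
  rewrite -(cvg_lim (@Rhausdorff R) (Sf x)).
  by apply: limr_ge; [exact: cvgP (Sf x)|exact: nearW].
have fE : (\int[mu]_x (f x)%:E)%E = l%:E.
  have h := @cvg_monotone_convergence _ _ _ mu _ measurableT (fun n x => (S n x)%:E).
  have {}h : (\int[mu]_x (S n x)%:E)%E @[n --> \oo] --> (\int[mu]_x (f x)%:E)%E.
    rewrite (_ : (\int[mu]_x (f x)%:E)%E = (\int[mu]_x limn (fun n => (S n x)%:E))%E).
      apply: h => [n|n x _|x _ m n mn]; [exact/measurable_EFinP|by rewrite lee_fin|].
      by rewrite lee_fin Snd.
    apply: eq_integral => x _; apply/esym/cvg_lim => //.
    by apply: cvg_EFin; [exact: nearW|exact: Sf].
  have h2 : (\int[mu]_x (S n x)%:E)%E @[n --> \oo] --> l%:E.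
    rewrite (_ : (fun n => _) = (fun n => (c n)%:E)).
      by apply: cvg_EFin; [exact: nearW|exact: cl].
    by apply/funext => n; rewrite (has_integralE (hS n)).
  exact: cvg_unique h h2.
split; last by rewrite /Rintegral fE.
apply/integrableP; split; first exact/measurable_EFinP.
rewrite [ltLHS](_ : _ = l%:E) ?ltry// -fE.
by apply: eq_integral => x _; rewrite /= ger0_norm.
Qed.

Lemma has_integral_dominated (S : nat -> T -> R) f g (c : nat -> R) l k :
  (forall n, has_integral (S n) (c n)) -> has_integral g k ->
  (forall n x, `|S n x| <= g x) -> (forall x, S ^~ x @ \oo --> f x) ->
  c @ \oo --> l -> has_integral f l.
Proof.
move=> hS [ig _] Sg Sf cl.
have mS n : measurable_fun setT (EFin \o S n).
  exact/measurable_EFinP/(has_integral_meas (hS n)).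
have cvS x : setT x -> EFin (S n x) @[n --> \oo] --> (f x)%:E.
  by move=> _; apply: cvg_EFin; [exact: nearW|exact: Sf].
have bS n x : setT x -> (`|(S n x)%:E| <= (g x)%:E)%E by move=> _; rewrite lee_fin.
have mf : measurable_fun setT (EFin \o f).
  apply/measurable_EFinP; apply: measurable_fun_cvg (fun n => has_integral_meas (hS n)) _.
  by move=> x _; exact: Sf.
have aS : {ae mu, forall x, setT x -> EFin (S n x) @[n --> \oo] --> (f x)%:E}.
  by apply: aeW => x; exact: cvS.
have aB : {ae mu, forall x n, setT x -> (`|(S n x)%:E| <= (g x)%:E)%E}.
  by apply: aeW => x n; exact: bS.
have [fi _ h] := dominated_convergence measurableT mS mf aS ig aB.
split=> //; rewrite /Rintegral.
suff -> : (\int[mu]_x (EFin \o f) x)%E = l%:E by [].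
have cE : (fun n => (c n)%:E) @ \oo --> (\int[mu]_x (EFin \o f) x)%E.
  apply: cvg_trans h; apply: near_eq_cvg; apply: nearW => n.
  exact: has_integralE (hS n).
by apply: cvg_unique cE _ => //; apply: cvg_EFin; [exact: nearW|exact: cl].
Qed.

End HasIntegral.

(** * Product measure: tensor products and the null diagonal *)

Section ProductIntegral.
Context (R : realType).
Notation leb := (@lebesgue_measure R).
Notation lebX := (leb \x leb)%E.
Implicit Types (f g : R -> R).

(** Tonelli applied to the absolute values gives integrability, then Fubini gives the value. *)
Lemma has_integral_prod f g a b : has_integral leb f a -> has_integral leb g b ->
  has_integral lebX (fun p => f p.1 * g p.2) (a * b).
Proof.
move=> hf hg; have mf := has_integral_meas hf; have mg := has_integral_meas hg.
have mfg : measurable_fun setT (fun p : R * R => (f p.1 * g p.2)%:E).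
  apply/measurable_EFinP; apply: measurable_funM.
    exact: measurableT_comp mf measurable_fst.
  exact: measurableT_comp mg measurable_snd.
have [/integrableP[_ fi] fa] := hf; have [/integrableP[_ gi] gb] := hg.
have ig : lebX.-integrable setT (fun p : R * R => (f p.1 * g p.2)%:E).
  apply/(integrable12ltyP leb leb mfg) => /=.
  rewrite [ltLHS](_ : _ =
    (\int[leb]_x (`|(f x)%:E| * \int[leb]_y `|(g y)%:E|))%E); last first.
    apply: eq_integral => x _; rewrite -ge0_integralZl//.
    - by apply: eq_integral => y _; rewrite /= normrM EFinM.
    - by apply: measurableT_comp => //; exact/measurable_EFinP.
  rewrite ge0_integralZr//.
  - by rewrite lte_mul_pinfty ?integral_ge0// ge0_fin_numE// integral_ge0.
  - by apply: measurableT_comp => //; exact/measurable_EFinP.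
  - exact: integral_ge0.
split=> //; rewrite /Rintegral -integral12_prod_meas1// /fubini_F/=.
rewrite [X in fine X](_ : _ = (\int[leb]_x (b%:E * (f x)%:E))%E); last first.
  apply: eq_integral => x _; rewrite -(has_integralE hg) muleC -integralZl//.
  by have [] := hg.
rewrite integralZl//; last by have [] := hf.
by rewrite (has_integralE hf) -EFinM/= mulrC.
Qed.

Lemma diag_null : measurable [set p : R * R | p.1 = p.2] /\
  lebX [set p : R * R | p.1 = p.2] = 0%E.
Proof.
have mD : measurable [set p : R * R | p.1 = p.2].
  rewrite (_ : [set p | _] = (fun p : R * R => p.1 - p.2) @^-1` [set 0]); last first.
    by apply/seteqP; split=> p /= /eqP h; apply/eqP; rewrite subr_eq0// -subr_eq0 in h *.
  rewrite -[X in measurable X]setTI; apply: measurable_funB => //.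
split=> //; rewrite /product_measure1.
rewrite (_ : (fun x => _) = cst 0%E) ?integral0//; apply/funext => x /=.
rewrite (_ : xsection _ _ = [set x]) ?lebesgue_measure_set1//.
apply/seteqP; split=> y /=; rewrite /xsection/= in_setE /=; first by move=> ->.
by [].
Qed.

End ProductIntegral.

(** * Averages over dyadic cells *)

Section StepFunctions.
Context (R : realType).
Notation leb := (@lebesgue_measure R).
Notation lebX := (leb \x leb)%E.
Implicit Types (u v : R -> R) (j : int) (k n : nat) (x y : R) (M N : nat).

Definition cell_ind j k x : R := (in_cell j k x)%:R.

(** A class closed under sums and products whose members are integrable over every cell, cells
    having finite measure. *)
Definition bounded_measurable u : Prop :=
  measurable_fun setT u /\ exists B, forall x, `|u x| <= B.

Definition cell_int j k u : R := Rintegral leb setT (fun x => u x * cell_ind j k x).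

Lemma has_integral_cell j k : has_integral leb (cell_ind j k) (2 ^ (- j)).
Proof.
pose a : R := k%:R * 2 ^ (- j); pose b : R := k.+1%:R * 2 ^ (- j).
have ab : a < b by rewrite ltr_pM2r ?exp2_gt0// ltr_nat.
have mA : measurable (`]a, b]%classic : set R) by exact: measurable_itv.
have muA : leb `]a, b]%classic = (2 ^ (- j))%:E.
  rewrite lebesgue_measure_itv/= lte_fin ab -EFinB; congr (_%:E).
  by rewrite /a /b -mulrBl -natrB ?leqnSn// subSnn mul1r.
have e : cell_ind j k = \1_(`]a, b]%classic).
  by apply/funext => x; rewrite indicE mem_setE in_itv.
split; rewrite e; last first.
  by rewrite /Rintegral integral_indic// setIT; exact: (congr1 fine muA).
apply: integrable_indic_itv.
Qed.

Lemma measurable_cell_ind j k : measurable_fun setT (cell_ind j k).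
Proof. exact: has_integral_meas (has_integral_cell j k). Qed.

Lemma has_integral_cell_int u j k : bounded_measurable u ->
  has_integral leb (fun x => u x * cell_ind j k x) (cell_int j k u).
Proof.
move=> [mu [B uB]]; split=> //.
have [h _] := has_integralZ B (has_integral_cell j k).
apply: le_integrable h => //.
  by apply/measurable_EFinP/measurable_funM => //; exact: measurable_cell_ind.
move=> x _; rewrite /= lee_fin normrM [leRHS]normrM ler_pM//.
by apply: (le_trans (uB x)); exact: ler_norm.
Qed.

Lemma cell_int_eq u j k c : has_integral leb (fun x => u x * cell_ind j k x) c ->
  cell_int j k u = c.
Proof. by case. Qed.

Lemma bounded_measurable_cst c : bounded_measurable (fun=> c).
Proof. by split=> //; exists `|c|. Qed.

Lemma bounded_measurableM u v : bounded_measurable u -> bounded_measurable v ->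
  bounded_measurable (fun x => u x * v x).
Proof.
move=> [mu [B uB]] [mv [C vC]]; split; first exact: measurable_funM.
by exists (B * C) => x; rewrite normrM ler_pM.
Qed.

Lemma bounded_measurableD u v : bounded_measurable u -> bounded_measurable v ->
  bounded_measurable (fun x => u x + v x).
Proof.
move=> [mu [B uB]] [mv [C vC]]; split; first exact: measurable_funD.
by exists (B + C) => x; rewrite (le_trans (ler_normD _ _))// lerD.
Qed.

Lemma bounded_measurable_cell j k : bounded_measurable (cell_ind j k).
Proof.
split; first exact: measurable_cell_ind.
by exists 1 => x; rewrite /cell_ind; case: in_cell; rewrite ?normr1 ?normr0.
Qed.

Lemma cell_int1 j k : cell_int j k (fun=> 1) = 2 ^ (- j).
Proof.
apply: cell_int_eq; apply: has_integral_ext (has_integral_cell j k) => x.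
by rewrite mul1r.
Qed.

Lemma cell_intD u v j k : bounded_measurable u -> bounded_measurable v ->
  cell_int j k (fun x => u x + v x) = cell_int j k u + cell_int j k v.
Proof.
move=> bu bv; apply: cell_int_eq.
apply: has_integral_ext (has_integralD (has_integral_cell_int j k bu)
  (has_integral_cell_int j k bv)) => x.
by rewrite mulrDl.
Qed.

Lemma cell_intZ u c j k : bounded_measurable u ->
  cell_int j k (fun x => c * u x) = c * cell_int j k u.
Proof.
move=> bu; apply: cell_int_eq.
apply: has_integral_ext (has_integralZ c (has_integral_cell_int j k bu)) => x.
by rewrite mulrA.
Qed.

Lemma cell_int_split u j k : bounded_measurable u ->
  cell_int j k u = cell_int (j + 1) k.*2 u + cell_int (j + 1) k.*2.+1 u.
Proof.
move=> bu; apply: cell_int_eq.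
apply: has_integral_ext (has_integralD (has_integral_cell_int _ _ bu)
  (has_integral_cell_int _ _ bu)) => x.
by rewrite -mulrDr -in_cell_split.
Qed.

Lemma sum_cell_ind j n x : 0 < x ->
  \sum_(k < n) cell_ind j k x = (cell_index j x < n)%:R.
Proof.
move=> x0; rewrite /cell_ind; under eq_bigr do rewrite in_cellE//.
case: ltnP => h; last first.
  by rewrite big1// => k _; rewrite gtn_eqF// (leq_trans (ltn_ord k)).
rewrite (bigD1 (Ordinal h))//= eqxx big1 ?addr0// => k kh.
by move: kh; rewrite -val_eqE /= eq_sym => /negbTE->.
Qed.

(** The inequality says that the first n cells of level j cover (0, 2^M], outside which u
    vanishes. *)
Lemma sum_cell_int u j n M : bounded_measurable u ->
  (forall x, ~~ in_cell (- M%:Z) 0 x -> u x = 0) -> 2 ^+ M <= n%:R * 2 ^ (- j) :> R ->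
  \sum_(k < n) cell_int j k u = cell_int (- M%:Z) 0 u.
Proof.
move=> bu us Mn; apply/esym/cell_int_eq.
apply: has_integral_ext (has_integral_sum n (fun k => has_integral_cell_int j k bu)) => x.
rewrite -mulr_sumr; have [h|/us ->] := boolP (in_cell (- M%:Z) 0 x); last by rewrite !mul0r.
have x0 := in_cell_gt0 h; rewrite sum_cell_ind// {1}/cell_ind h; congr (_ * _).
rewrite cell_index_lt//; apply: le_trans Mn.
by move: h => /andP[_]; rewrite opprK mul1r.
Qed.

(** The indicator of ~_j cut to finitely many cells, that is 2^(-j) times the kernel of P_j. Written
    as a sum of products, so that integration against u(x) v(y) factorizes. *)
Definition cell_kernel j n (p : R * R) : R :=
  \sum_(k < n) cell_ind j k p.1 * cell_ind j k p.2.

Lemma cell_kernel_pos j n p : 0 < p.1 -> 0 < p.2 ->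
  cell_kernel j n p = ((cell_index j p.1 == cell_index j p.2) && (cell_index j p.1 < n)%N)%:R.
Proof.
move=> x0 y0; rewrite /cell_kernel /cell_ind.
under eq_bigr do rewrite !in_cellE// -natrM mulnb.
have [e|ne] := eqVneq (cell_index j p.1) (cell_index j p.2).
  rewrite -e /= -sum_cell_ind//; apply: eq_bigr => k _.
  by rewrite /cell_ind in_cellE// andbb.
rewrite big1//= => k _; case: eqP => //= ek; case: eqP => //= ek'.
by move: ne; rewrite ek ek' eqxx.
Qed.

Lemma cell_kernel_le0 j n p : ~~ ((0 < p.1) && (0 < p.2)) -> cell_kernel j n p = 0.
Proof.
move=> h; rewrite /cell_kernel big1// => k _; rewrite /cell_ind.
case h1: (in_cell j k p.1); rewrite ?mul0r//; case h2: (in_cell j k p.2); rewrite ?mulr0//.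
by move: h; rewrite (in_cell_gt0 h1) (in_cell_gt0 h2).
Qed.

Lemma cell_kernel_ge0 j n p : 0 <= cell_kernel j n p.
Proof. by apply: sumr_ge0 => k _; rewrite mulr_ge0. Qed.

Lemma has_integral_kernel u v j n : bounded_measurable u -> bounded_measurable v ->
  has_integral lebX (fun p => cell_kernel j n p * (u p.1 * v p.2))
    (\sum_(k < n) cell_int j k u * cell_int j k v).
Proof.
move=> bu bv; apply: has_integral_ext (has_integral_sum n (fun k =>
  has_integral_prod (has_integral_cell_int j k bu) (has_integral_cell_int j k bv))) => p.
by rewrite /cell_kernel mulr_suml; apply: eq_bigr => k _; rewrite mulrACA mulrC.
Qed.

(* [in_cell (- M) 0] is the interval (0, 2^M]. *)
Record mean_zero_step M N u : Prop := MeanZeroStep {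
  step_bm : bounded_measurable u;
  step_supp : forall x, ~~ in_cell (- M%:Z) 0 x -> u x = 0;
  step_cst : forall k x y, in_cell N k x -> in_cell N k y -> u x = u y;
  step_mean : cell_int (- M%:Z) 0 u = 0 }.

Definition inner M u v := cell_int (- M%:Z) 0 (fun x => u x * v x).

(* <P_j u, P_j v> for j = n - M: on functions supported in (0, 2^M] only the first
   2^n cells of level j matter, and n = 0 is the level of (0, 2^M] itself. *)
Definition level_inner M n u v : R :=
  2 ^ (n%:Z - M%:Z) *
  \sum_(k < 2 ^ n) cell_int (n%:Z - M%:Z) k u * cell_int (n%:Z - M%:Z) k v.

Lemma level_inner0 M N u v : mean_zero_step M N u -> level_inner M 0 u v = 0.
Proof. by move=> [_ _ _ m]; rewrite /level_inner big_ord1 sub0r m mul0r mulr0. Qed.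

Lemma sum_ord_double n (F : nat -> R) :
  \sum_(k < n.*2) F k = \sum_(k < n) (F k.*2 + F k.*2.+1).
Proof.
elim: n => [|n IH]; first by rewrite !big_ord0.
by rewrite doubleS !big_ord_recr /= IH addrA.
Qed.

(** If the two halves of a cell of level j have integrals a and b, the gap is 2^(j+1) (a^2 + b^2) -
    2^j (a + b)^2 = 2^j (a - b)^2, the squared Haar coefficient of that cell. *)
Lemma level_inner_le M n u : bounded_measurable u ->
  level_inner M n u u <= level_inner M n.+1 u u.
Proof.
move=> bu; rewrite /level_inner.
have -> : n.+1%:Z - M%:Z = n%:Z - M%:Z + 1 by lia.
move: (n%:Z - M%:Z) => j; rewrite expnS mul2n.
rewrite (sum_ord_double _ (fun k => cell_int (j + 1) k u * cell_int (j + 1) k u)).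
rewrite expfzDr ?pnatr_eq0// expr1z -mulrA.
rewrite ler_pM2l ?exp2_gt0// mulr_sumr; apply: ler_sum => k _.
rewrite (cell_int_split j k bu).
set a := cell_int _ _ _; set b := cell_int _ _ _.
by have := sqr_ge0 (a - b); rewrite -subr_ge0; move: a b => a b; lra.
Qed.

Lemma in_cell_nest j m k x : j <= m -> in_cell m k x ->
  forall y, in_cell m k y -> in_cell j (cell_index j x) y.
Proof.
move=> jm hx y hy; have x0 := in_cell_gt0 hx; have y0 := in_cell_gt0 hy.
rewrite in_cellE// eq_sym; apply/eqP; apply: (same_cell_le x0 y0 jm).
by move: hx hy; rewrite !in_cellE// => /eqP -> /eqP ->.
Qed.

Lemma cell_int_cst M N u m k : mean_zero_step M N u -> N%:Z <= m ->
  exists c, (forall x, in_cell m k x -> u x = c) /\ cell_int m k u = c * 2 ^ (- m).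
Proof.
(* The right endpoint belongs to the cell and serves as sample point. *)
move=> [_ _ uc _] Nm; set z : R := k.+1%:R * 2 ^ (- m).
have hz : in_cell m k z by rewrite /in_cell lexx andbT ltr_pM2r ?exp2_gt0// ltr_nat.
have hu x : in_cell m k x -> u x = u z.
  by move=> hx; apply: (uc (cell_index N%:Z x)); exact: (in_cell_nest Nm hx).
exists (u z); split=> //; apply: cell_int_eq.
apply: has_integral_ext (has_integralZ (u z) (has_integral_cell m k)) => x.
by rewrite /cell_ind; case h: in_cell; rewrite ?mulr0// hu.
Qed.

(** The bound on n means that the level n - M is at least N, where u and v are constants c and d on
    each cell; the product of their cell integrals is then 2^(-m) times the integral of uv. *)
Lemma level_inner_fine M N u v n : mean_zero_step M N u -> mean_zero_step M N v ->
  (M + N <= n)%N -> level_inner M n u v = inner M u v.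
Proof.
move=> hu hv Kn; rewrite /level_inner /inner; set m := n%:Z - M%:Z.
have Nm : N%:Z <= m by rewrite /m; lia.
rewrite -(@sum_cell_int _ m (2 ^ n)).
- rewrite mulr_sumr; apply: eq_bigr => k _.
  have [c [uc ->]] := cell_int_cst k hu Nm; have [d [vd ->]] := cell_int_cst k hv Nm.
  have e : cell_int m k (fun x => u x * v x) = (c * d) * 2 ^ (- m).
    apply: cell_int_eq.
    apply: has_integral_ext (has_integralZ (c * d) (has_integral_cell m k)) => x.
    by rewrite /cell_ind; case h: in_cell; rewrite ?mulr0// uc// vd.
  rewrite e -!invr_expz; have := lt0r_neq0 (exp2_gt0 R m); move: (2 ^ m) => t t0.
  by field.
- exact: bounded_measurableM (step_bm hu) (step_bm hv).
- by move=> x /(step_supp hu) ->; rewrite mul0r.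
- rewrite natrX /m opprB expfzDr ?pnatr_eq0// -[2 ^ M%:Z]/(2 ^+ M) exp2N_nat.
  by rewrite mulrCA divff ?mulr1// expf_neq0// pnatr_eq0.
Qed.

Lemma cell_int_coarse M N u j : mean_zero_step M N u -> j <= - M%:Z -> cell_int j 0 u = 0.
Proof.
move=> hu jM; rewrite -(step_mean hu); congr Rintegral; apply/funext => x.
rewrite /cell_ind; case h: (in_cell (- M%:Z) 0 x); last by rewrite (step_supp hu) ?h// !mul0r.
suff -> : in_cell j 0 x by [].
move: h => /andP[h1 h2]; rewrite /in_cell mul0r; move: h1; rewrite mul0r => ->/=.
by apply: (le_trans h2); rewrite !mul1r ler_eXz2l ?ltr1n//; lia.
Qed.

(** Expand the square. Each pure term integrates to 2^(-j) times the squared norm, because every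
    cell has measure 2^(-j) and the n cells cover the support; the cross term gives the sum. *)
Lemma has_integral_level_energy M N u j n : mean_zero_step M N u ->
  2 ^+ M <= n%:R * 2 ^ (- j) :> R ->
  has_integral lebX (fun p => cell_kernel j n p * (u p.1 - u p.2) ^+ 2)
    (2 * (2 ^ (- j) * inner M u u - \sum_(k < n) cell_int j k u ^+ 2)).
Proof.
move=> hu Mn; have bu := step_bm hu; have b1 := bounded_measurable_cst 1.
have bu2 := bounded_measurableM bu bu.
have h := has_integralD (has_integralD (has_integral_kernel j n bu2 b1)
  (has_integral_kernel j n b1 bu2)) (has_integralZ (- 2) (has_integral_kernel j n bu bu)).
have e : \sum_(k < n) cell_int j k (fun x => u x * u x) * cell_int j k (fun=> 1)
    = 2 ^ (- j) * inner M u u.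
  rewrite /inner -(sum_cell_int bu2 _ Mn); last by move=> x /(step_supp hu) ->; rewrite mul0r.
  by rewrite mulr_sumr; apply: eq_bigr => k _; rewrite cell_int1 mulrC.
have e' : \sum_(k < n) cell_int j k (fun=> 1) * cell_int j k (fun x => u x * u x)
    = 2 ^ (- j) * inner M u u by rewrite -e; apply: eq_bigr => k _; rewrite mulrC.
rewrite e e' in h.
have -> : 2 * (2 ^ (- j) * inner M u u - \sum_(k < n) cell_int j k u ^+ 2) =
  2 ^ (- j) * inner M u u + 2 ^ (- j) * inner M u u +
  - 2 * \sum_(k < n) cell_int j k u * cell_int j k u.
  under [X in _ - X]eq_bigr do rewrite expr2.
  ring.
by apply: has_integral_ext h => p; ring.
Qed.

End StepFunctions.

(** * The potential form *)

Section QuadraticForms.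
Context (R : realType).
Notation leb := (@lebesgue_measure R).
Notation lebX := (leb \x leb)%E.
Implicit Types (u v : R -> R) (j : int) (k n : nat) (x y : R) (M N K : nat).

Lemma dyadic_dist_diag x : 0 < x -> dyadic_dist x x = 0.
Proof.
move=> x0; rewrite /dyadic_dist; set E := [set d | _].
have Ej j : E (2 ^ (- j)).
  by exists j, (cell_index j x); split=> //; split; apply/andP; exact: cell_indexP.
have E0 : lbound E 0 by move=> _ [j [k [-> _]]]; rewrite ltW// exp2_gt0.
apply/eqP; rewrite eq_le lb_le_inf//; last by exists (2 ^ (- 0)); exact: Ej.
rewrite andbT leNgt; apply/negP => i0; have [b hb] := exists_exp2_ge (inf E)^-1.
have /(_ (2 ^ (- b.+1%:Z)))/= := ge_inf (ex_intro _ 0 E0) => /(_ (Ej _)).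
rewrite leNgt => /negP; apply; rewrite exp2N_nat -[ltRHS]invrK.
rewrite ltf_pV2 ?posrE ?invr_gt0 ?exprn_gt0//.
by apply: (le_lt_trans hb); rewrite ltr_eXn2l ?ltr1n.
Qed.

(** Level masses are constant from some index on, so the remainder of either series is geometric and
    explicit. *)
Lemma cvg_sum_geometric (a X : R) (x : nat -> R) K : 0 < a -> a < 1 ->
  (forall i, (K <= i)%N -> x i = X) ->
  (fun n => \sum_(i < n) a ^+ i * x i) @ \oo -->
    \sum_(i < K) a ^+ i * x i + X * a ^+ K / (1 - a).
Proof.
move=> a0 a1 xX; set L := (X in _ --> X); rewrite -(cvg_shiftn K) /=.
have a1' : 1 - a != 0 by rewrite subr_eq0 gt_eqF.
have e m : \sum_(i < m + K) a ^+ i * x i = L - X * a ^+ K / (1 - a) * a ^+ m.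
  elim: m => [|m IH]; first by rewrite expr0 mulr1 /L addrK.
  rewrite addSn big_ord_recr/= IH xX ?leq_addl// exprS exprD.
  by field.
under eq_cvg do rewrite e.
have : (fun m => L - X * a ^+ K / (1 - a) * a ^+ m) @ \oo --> L - X * a ^+ K / (1 - a) * 0.
  apply: cvgB; first exact: cvg_cst.
  by apply: cvgMr; apply: cvg_expr; rewrite ger0_norm// ltW.
by rewrite mulr0 subr0.
Qed.

Lemma nondecreasing_sum_ord (F : nat -> R) : (forall i, 0 <= F i) ->
  nondecreasing_seq (fun n => \sum_(i < n) F i).
Proof.
by move=> F0; apply/nondecreasing_seqP => n; rewrite big_ord_recr/= lerDl.
Qed.

Lemma ltr_pow2 x y : x < y -> (2 : R) `^ x < 2 `^ y.
Proof.
by move=> xy; rewrite /powR pnatr_eq0/= ltr_expR ltr_pM2r// ln_gt0// ltr1n.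
Qed.

Section Potential.
Variables (r : R) (M : nat).
Hypotheses (r_gt0 : 0 < r) (r_lt1 : r < 1).
(** Used with r = 1 - 2s: [rho] is the ratio of the kernel values at consecutive levels, and
    [a = rho / 2] is what remains after the factor 2^(-j) from the cell measure. *)
Let rho : R := 2 `^ r.
Let a : R := 2 `^ (r - 1).

(* The weights make the partial sums telescope to [rho ^ (q - M)]; the term [i = 0]
   stands for all levels coarser than (0, 2^M] together. *)
Definition potential_weight i : R :=
  if i is 0 then rho ^ (- M%:Z) else rho ^ (i%:Z - M%:Z) * (1 - rho^-1).

Let w := potential_weight.

Let rho_gt1 : 1 < rho.
Proof. by rewrite /rho -[X in X < _](powRr0 2) ltr_pow2. Qed.

Let rho_gt0 : 0 < rho. Proof. exact: lt_trans rho_gt1. Qed.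

Let rho_unit : rho != 0. Proof. exact: lt0r_neq0. Qed.

Let rhoE : rho = 2 * a.
Proof.
rewrite /rho /a -{2}[2]powRr1// -powRD ?pnatr_eq0 ?implybT//.
by congr (_ `^ _); ring.
Qed.

Let a_gt0 : 0 < a. Proof. by rewrite powR_gt0. Qed.

Let a_lt1 : a < 1.
Proof.
by rewrite /a -[X in _ < X](powRr0 2) ltr_pow2// subr_lt0.
Qed.

Let c_ge0 : 0 <= 1 - rho^-1.
Proof. by rewrite subr_ge0 invf_le1 ?ltW. Qed.

Lemma potential_weight_ge0 i : 0 <= w i.
Proof. by case: i => [|i]; rewrite /w/= ?mulr_ge0// ltW// exprz_gt0. Qed.

Lemma sum_potential_weight q : \sum_(i < q.+1) w i = rho ^ (q%:Z - M%:Z).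
Proof.
elim: q => [|q IH]; first by rewrite big_ord1 /w/= sub0r.
rewrite big_ord_recr IH/=.
have -> : q.+1%:Z - M%:Z = 1 + (q%:Z - M%:Z) by lia.
by rewrite [rho ^ (1 + _)]expfzDr// expr1z; field.
Qed.

(* The diagonal is removed because the series diverges there. *)
Definition potential_partial n (p : R * R) : R :=
  (p.1 != p.2)%:R * \sum_(i < n) w i * cell_kernel (i%:Z - M%:Z) (2 ^ i) p.

Lemma potential_partial_ge0 n p : 0 <= potential_partial n p.
Proof.
rewrite mulr_ge0// sumr_ge0// => i _.
by rewrite mulr_ge0 ?potential_weight_ge0 ?cell_kernel_ge0.
Qed.

Lemma potential_partial_nd p : nondecreasing_seq (potential_partial ^~ p).
Proof.
move=> m n mn; rewrite ler_wpM2l//.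
apply: (nondecreasing_sum_ord (F := fun i => w i * cell_kernel (i%:Z - M%:Z) (2 ^ i) p)) => // i.
by rewrite mulr_ge0 ?potential_weight_ge0 ?cell_kernel_ge0.
Qed.

(** The kernel of Q cut to the square (0, 2^M]^2, where it is integrable; functions supported in (0,
    2^M] do not see the cut. *)
Definition potential (p : R * R) : R :=
  if [&& p.1 != p.2, in_cell (- M%:Z) 0 p.1 & in_cell (- M%:Z) 0 p.2]
  then dyadic_dist p.1 p.2 `^ (1 - r) / dyadic_dist p.1 p.2 else 0.

Lemma in_cell_root i x : 0 < x ->
  (cell_index (i%:Z - M%:Z) x < 2 ^ i)%N = in_cell (- M%:Z) 0 x.
Proof.
move=> x0; have e : (2 ^ i)%:R * 2 ^ (- (i%:Z - M%:Z)) = 2 ^+ M :> R.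
  rewrite natrX opprB expfzDr ?pnatr_eq0// -[2 ^ M%:Z]/(2 ^+ M) exp2N_nat.
  by rewrite mulrCA divff ?mulr1// expf_neq0// pnatr_eq0.
rewrite /in_cell mul0r x0 mul1r opprK /=; apply/idP/idP => h.
  have [_ /le_trans] := cell_indexP (i%:Z - M%:Z) x0; apply.
  by rewrite -[2 ^ M%:Z]/(2 ^+ M) -e ler_pM2r ?exp2_gt0// ler_nat.
by apply: cell_index_lt => //; rewrite e.
Qed.

Lemma potential_partial_cvg p : potential_partial ^~ p @ \oo --> potential p.
Proof.
have [pos|npos] := boolP ((0 < p.1) && (0 < p.2)); last first.
  have -> : potential p = 0.
    rewrite /potential; case: ifP => // /and3P[_ h1 h2].
    by move: npos; rewrite (in_cell_gt0 h1) (in_cell_gt0 h2).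
  rewrite (_ : potential_partial ^~ p = cst 0); first exact: cvg_cst.
  apply/funext => n; rewrite /potential_partial big1 ?mulr0// => i _.
  by rewrite cell_kernel_le0// mulr0.
have /andP[x0 y0] := pos; rewrite /potential.
case: ifP => [/and3P[xy h1 h2]|h]; last first.
  rewrite (_ : potential_partial ^~ p = cst 0); first exact: cvg_cst.
  apply/funext => n; rewrite /potential_partial; move: h.
  case: (p.1 != p.2) => /= h; last by rewrite mul0r.
  rewrite big1 ?mulr0// => i _; rewrite cell_kernel_pos//.
  case: eqP => [e|_] /=; last by rewrite mulr0.
  (* Two points of one cell are both inside (0, 2^M] or both outside; here they are outside, beyond
     the first 2^i cells. *)
  have h1 := in_cell_root i x0; have h2 := in_cell_root i y0.
  by rewrite -e in h2; rewrite -h1 -h2 andbb in h; rewrite h mulr0.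
have [m hm] := separation_level x0 y0 xy.
rewrite (dyadic_kernelE _ x0 y0 hm) opprB addrC subrK -/rho.
have Mm : - M%:Z <= m.
  rewrite -hm; move: h1 h2; rewrite !in_cellE// => /eqP -> /eqP ->.
  by [].
have [q qE] : exists q : nat, m = q%:Z - M%:Z 
  by exists (absz (m + M%:Z)); rewrite gez0_abs ?addrK// -lerBlDr sub0r.
(* Only the levels i <= q contribute, so the partial sums equal the telescoped value rho^m as soon
   as n > q. *)
have h : (fun=> rho ^ m) @ \oo --> rho ^ m by exact: cvg_cst.
apply: cvg_trans h; apply: near_eq_cvg.
exists q.+1 => // n /= qn; rewrite /potential_partial xy mul1r qE.
rewrite -sum_potential_weight -(subnKC qn) big_split_ord /=.
rewrite [X in _ = _ + X]big1 ?addr0 => [|i _].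
  apply: eq_bigr => i _; rewrite cell_kernel_pos// hm in_cell_root// h1 andbT.
  by rewrite (_ : _ <= _) ?mulr1// qE lerD2r lez_nat -ltnS.
rewrite cell_kernel_pos// hm (_ : (_ <= _) = false) ?mulr0//.
by rewrite qE lerD2r lez_nat; apply/negbTE; rewrite -ltnNge leq_addr.
Qed.

Lemma has_integral_potential_partial u v n : bounded_measurable u -> bounded_measurable v ->
  has_integral lebX (fun p => potential_partial n p * (u p.1 * v p.2))
    (\sum_(i < n) w i * (2 ^ (M%:Z - i%:Z) * level_inner M i u v)).
Proof.
move=> bu bv; have [mD D0] := diag_null R.
have h := has_integral_sum n (fun i => has_integralZ (w i)
  (has_integral_kernel (i%:Z - M%:Z) (2 ^ i) bu bv)).
have {h} : has_integral lebX (fun p =>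
    (\sum_(i < n) w i * cell_kernel (i%:Z - M%:Z) (2 ^ i) p) * (u p.1 * v p.2))
    (\sum_(i < n) w i * (2 ^ (M%:Z - i%:Z) * level_inner M i u v)).
  rewrite (_ : (\sum_(i < n) _) = \sum_(i < n)  w i * (\sum_(k < 2 ^ i)
     cell_int (i%:Z - M%:Z) k u * cell_int (i%:Z - M%:Z) k v)).
    apply: has_integral_ext h => p; rewrite mulr_suml; apply: eq_bigr => i _.
    by rewrite mulrA.
  apply: eq_bigr => i _; rewrite /level_inner [2 ^ _ * _]mulrA -expfzDr ?pnatr_eq0//.
  by rewrite addrA subrK subrr expr0z mul1r.
move=> h; apply: (has_integral_ae (mu := lebX) mD D0 _ _ h).
  apply: measurable_funM; last first.
    apply: measurable_funM.
      exact: measurableT_comp (proj1 bu) measurable_fst.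
    exact: measurableT_comp (proj1 bv) measurable_snd.
  apply: measurable_funM; last first.
    (* Measurability of the kernel sum is read off from its integrability against u = v = 1. *)
    have h1 := has_integral_sum n (fun i => has_integralZ (w i)
      (has_integral_kernel (i%:Z - M%:Z) (2 ^ i) (bounded_measurable_cst 1) (bounded_measurable_cst 1))).
    apply: eq_measurable_fun (has_integral_meas h1) => p _.
    by apply: eq_bigr => i _; rewrite !mulr1.
  rewrite (_ : (fun p => _) = \1_(~` [set p : R * R | p.1 = p.2])).
    by apply: measurable_indic; exact: measurableC.
  by apply/funext => p; rewrite indicE; congr ((nat_of_bool _)%:R);
    apply/idP/idP => [/eqP ne|/set_mem ne]; [exact/mem_set|exact/eqP].
move=> p /eqP ne; rewrite /potential_partial.
by rewrite (_ : (p.1 != p.2) = true) ?mul1r//; apply/eqP => e; move: ne => /eqP.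
Qed.

(** Corrects for the weight at i = 0, which lacks the factor 1 - 1/rho. It matters for the majorant,
    where u = v = 1; in the mean-zero case it multiplies 0. *)
Let theta i : R := if i is 0 then (1 - rho^-1)^-1 else 1.

Let C := (a ^+ M)^-1 * (1 - rho^-1).

Let weightE i : w i * 2 ^ (M%:Z - i%:Z) = C * (a ^+ i * theta i).
Proof.
have c0 : 1 - rho^-1 != 0 by rewrite subr_eq0 eq_sym invr_eq1 gt_eqF.
have aM : a ^+ M != 0 by rewrite expf_neq0// gt_eqF.
have e : rho ^ (i%:Z - M%:Z) * 2 ^ (M%:Z - i%:Z) = (a ^+ M)^-1 * a ^+ i.
  rewrite -[M%:Z - _]opprB -invr_expz rhoE exprzMl ?unitfE ?pnatr_eq0 ?gt_eqF//.
  rewrite mulrAC divff ?mul1r; last by rewrite gt_eqF ?exp2_gt0.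
  by rewrite expfzDr ?gt_eqF// mulrC -invr_expz.
case: i e => [|i] e; rewrite /w /C /theta.
  move: e; rewrite expr0 sub0r /= => ->.
  by rewrite mulr1 mul1r mulfK.
by rewrite -[potential_weight _]/(rho ^ (i.+1%:Z - M%:Z) * (1 - rho^-1)) mulrAC e; ring.
Qed.

Let cvg_weights (x : nat -> R) A K : (forall i, (K <= i)%N -> x i = A) ->
  (fun n => \sum_(i < n) w i * (2 ^ (M%:Z - i%:Z) * x i)) @ \oo -->
  C * (\sum_(i < K.+1) a ^+ i * (theta i * x i) + A * a ^+ K.+1 / (1 - a)).
Proof.
move=> xA; rewrite (_ : (fun n => _) =
    (fun n => C * \sum_(i < n) a ^+ i * (theta i * x i))).
  apply: cvgMr; apply: (cvg_sum_geometric (x := fun i => theta i * x i)) => // -[//|i] Ki.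
  by rewrite /theta mul1r xA// ltnW.
apply/funext => n; rewrite mulr_sumr; apply: eq_bigr => i _.
by rewrite [LHS]mulrA weightE -!mulrA.
Qed.

Let level_inner1 i : level_inner M i (fun=> 1 : R) (fun=> 1) = 2 ^+ M.
Proof.
rewrite /level_inner (eq_bigr (fun=> (2 ^ (- (i%:Z - M%:Z))) ^+ 2)) => [|k _]; last first.
  by rewrite !cell_int1 expr2.
rewrite sumr_const card_ord -[_ *+ (2 ^ i)%N]mulr_natl natrX -invr_expz.
have -> : 2 ^ (i%:Z - M%:Z) = (2 ^+ i) / 2 ^+ M :> R.
  by rewrite expfzDr ?pnatr_eq0// exp2N_nat.
have : (2 : R) ^+ i != 0 by rewrite expf_neq0// pnatr_eq0.
have : (2 : R) ^+ M != 0 by rewrite expf_neq0// pnatr_eq0.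
by move: (2 ^+ i) (2 ^+ M) => s t ? ?; field; apply/andP.
Qed.

Lemma has_integral_potential u v (A : R) K : bounded_measurable u -> bounded_measurable v ->
  (forall i, (K <= i)%N -> level_inner M i u v = A) -> level_inner M 0 u v = 0 ->
  has_integral lebX (fun p => potential p * (u p.1 * v p.2))
    ((a ^+ M)^-1 * (1 - rho^-1) *
     (\sum_(i < K) a ^+ i * level_inner M i u v + A * a ^+ K / (1 - a))).
Proof.
move=> bu bv hA h0; have b1 := bounded_measurable_cst (1 : R).
(* Case u = v = 1: all terms are nonnegative and every level gives 2^M. A multiple of [potential]
   then dominates the signed partial sums. *)
have pot : has_integral lebX potential
    (C * (\sum_(i < 1) a ^+ i * (theta i * level_inner M i (fun=> 1) (fun=> 1)) +
      2 ^+ M * a ^+ 1 / (1 - a))).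
  apply: (has_integral_monotone (fun n => has_integral_potential_partial n b1 b1)).
  - by move=> n p; rewrite !mulr1 potential_partial_ge0.
  - by move=> p m n mn; rewrite !mulr1; exact: potential_partial_nd.
  - by move=> p; under eq_cvg do rewrite !mulr1; exact: potential_partial_cvg.
  - by apply: (@cvg_weights (fun i => level_inner M i (fun=> 1) (fun=> 1)) _ 0) => i _;
      exact: level_inner1.
have [_ [B uB]] := bu; have [_ [D vD]] := bv.
have := cvg_weights hA.
rewrite (_ : C * _ = C * (\sum_(i < K) a ^+ i * level_inner M i u v + A * a ^+ K / (1 - a))).
  apply: (has_integral_dominated (fun n => has_integral_potential_partial n bu bv)
    (has_integralZ (B * D) pot)) => [n p|p].
  - rewrite normrM mulrC normrM ler_pM//; first by rewrite ler_pM.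
    rewrite ger0_norm ?potential_partial_ge0//.
    rewrite -(cvg_lim (@Rhausdorff R) (@potential_partial_cvg p)).
    apply: nondecreasing_cvgn_le; first exact: potential_partial_nd.
    by apply/cvg_ex; exists (potential p); exact: potential_partial_cvg.
  - apply: cvgM; [exact: potential_partial_cvg|exact: cvg_cst].
congr (C * _); rewrite (eq_bigr (fun i : 'I_K.+1 => a ^+ i * level_inner M i u v)).
  rewrite big_ord_recr /= hA// exprS; field.
  by rewrite subr_eq0 gt_eqF.
move=> [[|i] hi] _ /=; last by rewrite /theta mul1r.
by rewrite h0 !mulr0.
Qed.

End Potential.
End QuadraticForms.

(** * The energy form *)

Section Energy.
Context (R : realType).
Notation leb := (@lebesgue_measure R).
Notation lebX := (leb \x leb)%E.
Variables (q : R) (M N : nat) (u : R -> R).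
Hypotheses (q_gt0 : 0 < q) (hu : mean_zero_step M N u).
Let K := (M + N)%N.
Let rho : R := 2 `^ (1 + q).
Let a : R := 2 `^ (- q).

(* Levels are enumerated downwards from N - 1: infinitely many coarse levels
   contribute to the energy, but none from N on, where u is constant on cells. *)
Let level i : int := N%:Z - i.+1%:Z.
(** Truncated subtraction is intended: from i = K - 1 on there is a single cell, which already
    contains (0, 2^M]. *)
Let ncells i : nat := 2 ^ (K - i.+1).
Let w i := rho ^ level i * (1 - rho^-1).

Let rho_gt1 : 1 < rho.
Proof. by rewrite /rho -[X in X < _](powRr0 2) ltr_pow2// addr_gt0. Qed.

Let rho_gt0 : 0 < rho. Proof. exact: lt_trans rho_gt1. Qed.

Let rho_unit : rho != 0. Proof. exact: lt0r_neq0. Qed.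

Let a_gt0 : 0 < a. Proof. by rewrite powR_gt0. Qed.

Let a_unit : a != 0. Proof. exact: lt0r_neq0. Qed.

Let a_lt1 : a < 1.
Proof. by rewrite /a -[X in _ < X](powRr0 2) ltr_pow2// oppr_lt0. Qed.

Let rhoE : rho = 2 * a^-1.
Proof.
rewrite /rho /a -powRN opprK -{2}[2]powRr1// -powRD ?pnatr_eq0 ?implybT//.
Qed.

Let w_ge0 i : 0 <= w i.
Proof. by rewrite mulr_ge0 ?ltW ?exprz_gt0// subr_gt0 invf_lt1. Qed.

Let level_large i : (K <= i)%N -> level i <= - M%:Z.
Proof. by rewrite /level /K => h; clear -h; lia. Qed.

Let level_small i : (i < K)%N -> level i = (K - i.+1)%:Z - M%:Z.
Proof. by rewrite /level /K => h; clear -h; lia. Qed.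

Let cover i : 2 ^+ M <= (ncells i)%:R * 2 ^ (- level i) :> R.
Proof.
rewrite natrX -[2 ^+ (K - i.+1)]/(2 ^ (K - i.+1)%:Z) -expfzDr ?pnatr_eq0//.
rewrite -[2 ^+ M]/(2 ^ M%:Z) ler_eXz2l ?ltr1n//.
by have := @level_small i; have := @level_large i; clear; case: (leqP K i); lia.
Qed.

Let partial n (p : R * R) : R :=
  \sum_(i < n) w i * (cell_kernel (level i) (ncells i) p * (u p.1 - u p.2) ^+ 2).

(** For i >= K the only relevant cell contains the whole support, so the level mass is 0 by mean
    zero and the full norm remains. *)
Let defect i : R :=
  if (i < K)%N then inner M u u - level_inner M (K - i.+1) u u else inner M u u.

Let partial_int n : has_integral lebX (partial n)
  ((2 * (1 - rho^-1) * a / a ^+ N) * \sum_(i < n) a ^+ i * defect i).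
Proof.
rewrite mulr_sumr.
have h := has_integral_sum n (fun i => has_integralZ (w i)
  (has_integral_level_energy hu (cover i))).
rewrite (eq_bigr (fun i : 'I_n => w i * (2 * (2 ^ (- level i) * inner M u u -
  \sum_(k < ncells i) cell_int (level i) k u ^+ 2)))) => [|i _]; first exact: h.
have -> : 2 ^ (- level i) * inner M u u - \sum_(k < ncells i) cell_int (level i) k u ^+ 2
    = 2 ^ (- level i) * defect i.
  rewrite /defect; case: ltnP => iK.
    rewrite /level_inner -level_small// -/(ncells i) mulrBr mulrA -expfzDr ?pnatr_eq0//.
    rewrite addNr expr0z mul1r.
    by under eq_bigr do rewrite expr2.
  have -> : ncells i = 1%N by rewrite /ncells (_ : (_ - _)%N = 0%N)//; apply/eqP; rewrite subn_eq0 ltnW.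
  by rewrite big_ord1 (cell_int_coarse hu) ?level_large// expr2 mul0r subr0.
have e : rho ^ level i * 2 ^ (- level i) = a * a ^+ i / a ^+ N.
  rewrite -invr_expz rhoE exprzMl ?unitfE ?pnatr_eq0 ?invr_eq0//.
  rewrite mulrAC divff ?mul1r; last by rewrite gt_eqF ?exp2_gt0.
  rewrite exprz_inv /level opprB expfzDr// -invr_expz -exprS.
  by [].
move: e; rewrite /w; move: (rho ^ level i) (2 ^ (- level i)) (defect i) (1 - rho^-1) (a ^- N).
move=> x y D c z e; have -> : x * c * (2 * (y * D)) = x * y * (2 * c * D) by ring.
by rewrite e; ring.
Qed.

Definition energy_density (p : R * R) : R :=
  if (0 < p.1) && (0 < p.2)
  then (u p.1 - u p.2) ^+ 2 * (dyadic_dist p.1 p.2 `^ (- q) / dyadic_dist p.1 p.2) else 0.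

Let partial_cvg p : partial ^~ p @ \oo --> energy_density p.
Proof.
rewrite /energy_density; case: ifPn => [/andP[x0 y0]|npos]; last first.
  rewrite (_ : partial ^~ p = cst 0); first exact: cvg_cst.
  by apply/funext => n; rewrite /partial big1// => i _; rewrite cell_kernel_le0// mul0r mulr0.
have [e|ne] := eqVneq (u p.1) (u p.2).
  rewrite e subrr expr0n mul0r (_ : partial ^~ p = cst 0); first exact: cvg_cst.
  by apply/funext => n; rewrite /partial big1// => i _; rewrite e subrr expr0n !mulr0.
have xy : p.1 != p.2 by apply: contra_neq ne => ->.
have [m hm] := separation_level x0 y0 xy.
rewrite (dyadic_kernelE _ x0 y0 hm) opprK -/rho.
have mN : m < N%:Z.
  rewrite ltNge -hm; apply/negP => /eqP e; move: ne => /eqP; apply.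
  by apply: (step_cst hu (k := cell_index N%:Z p.1)); rewrite in_cellE// e.
have kerE i : cell_kernel (level i) (ncells i) p = (level i <= m)%R%:R.
  rewrite cell_kernel_pos// -hm; case: eqP => //= e; rewrite (_ : (_ < _)%N = true)//.
  (* The cut to [ncells i] cells loses nothing: since u differs at the two points, one of them lies
     in the support, and its cell index is the common one. *)
  have lt z : 0 < z -> u z != 0 -> (cell_index (level i) z < ncells i)%N.
    move=> z0 uz; apply: cell_index_lt => //; apply: le_trans (cover i).
    have : in_cell (- M%:Z) 0 z by apply: contraNT uz => /(step_supp hu) ->.
    by move=> /andP[_]; rewrite opprK mul1r.
  have [ux|ux] := eqVneq (u p.1) 0; last exact: lt.
  by rewrite e; apply: lt => //; rewrite -ux eq_sym.
have [t tE] : exists t : nat, m = level t.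
  exists (absz (N%:Z - 1 - m)%R); rewrite /level; clear - mN; lia.
(* The first t levels are finer than m and contribute nothing; the following ones form a geometric
   series of ratio 1/rho with total rho^m. *)
have partE n : partial (n + t)%N p = (u p.1 - u p.2) ^+ 2 * rho ^ m * (1 - rho^-1 ^+ n).
  elim: n => [|n IH].
    rewrite expr0 subrr mulr0 /partial big1// => i _; rewrite kerE.
    rewrite (_ : (_ <= _) = false) ?mul0r ?mulr0// tE /level.
    by have := ltn_ord i; clear; move: (nat_of_ord i) => i' ?; lia.
  rewrite addSn [LHS]big_ord_recr /= -/(partial (n + t) p) IH kerE.
  rewrite (_ : (_ <= _) = true); last by rewrite tE /level; clear; lia.
  have -> : w (n + t)%N = rho ^ m * rho^-1 ^+ n * (1 - rho^-1).
    rewrite /w; congr (_ * _); rewrite tE.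
    have -> : level (n + t) = level t - n%:Z by rewrite /level; clear; lia.
    by rewrite expfzDr// -invr_expz exprVn.
  by rewrite [rho^-1 ^+ n.+1]exprS /=; ring.
rewrite -(cvg_shiftn t) /=; under eq_cvg do rewrite partE.
have : (fun n => (u p.1 - u p.2) ^+ 2 * rho ^ m * (1 - rho^-1 ^+ n)) @ \oo -->
    (u p.1 - u p.2) ^+ 2 * rho ^ m * (1 - 0).
  apply: cvgMr; apply: cvgB; first exact: cvg_cst.
  by apply: cvg_expr; rewrite ger0_norm ?invr_ge0 ?ltW// invf_lt1.
by rewrite subr0 mulr1.
Qed.

Lemma has_integral_energy : has_integral lebX energy_density
  ((2 * (1 - rho^-1) * a / a ^+ N) *
   (\sum_(i < K) a ^+ i * (inner M u u - level_inner M (K - i.+1) u u)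
    + inner M u u * a ^+ K / (1 - a))).
Proof.
have term_ge0 i p : 0 <= w i * (cell_kernel (level i) (ncells i) p * (u p.1 - u p.2) ^+ 2).
  by rewrite mulr_ge0// mulr_ge0 ?cell_kernel_ge0 ?sqr_ge0.
apply: (has_integral_monotone partial_int).
- by move=> n p; rewrite sumr_ge0.
- move=> p; apply: (nondecreasing_sum_ord (F := fun i =>
    w i * (cell_kernel (level i) (ncells i) p * (u p.1 - u p.2) ^+ 2))) => i.
  exact: term_ge0.
- by move=> p; exact: partial_cvg.
apply: cvgMr.
rewrite (eq_bigr (fun i : 'I_K => a ^+ i * defect i)) => [|i _].
  by apply: cvg_sum_geometric => // i Ki; rewrite /defect ltnNge Ki.
by rewrite /defect ltn_ord.
Qed.

End Energy.

(** * Haar functions and a weighted Cauchy-Schwarz inequality *)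

Section HaarSpan.
Context (R : realType).
Notation leb := (@lebesgue_measure R).
Implicit Types (u v : R -> R) (M N : nat).

Lemma mean_zero_step0 M N : mean_zero_step M N (fun=> 0 : R).
Proof.
split=> //; first exact: bounded_measurable_cst.
by apply: cell_int_eq; apply: has_integral_ext (has_integral0 _) => x; rewrite mul0r.
Qed.

Lemma mean_zero_stepD M N u v : mean_zero_step M N u -> mean_zero_step M N v ->
  mean_zero_step M N (fun x => u x + v x).
Proof.
move=> [bu su cu mu] [bv sv cv mv]; split; first exact: bounded_measurableD.
- by move=> x hx; rewrite su// sv// addr0.
- by move=> k x y hx hy; rewrite (cu k x y)// (cv k x y).
- by rewrite cell_intD// mu mv addr0.
Qed.

Lemma mean_zero_stepZ M N c u : mean_zero_step M N u ->
  mean_zero_step M N (fun x => c * u x).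
Proof.
move=> [bu su cu mu]; split.
- exact: bounded_measurableM (bounded_measurable_cst c) bu.
- by move=> x hx; rewrite su// mulr0.
- by move=> k x y hx hy; rewrite (cu k x y).
- by rewrite cell_intZ// mu mulr0.
Qed.

Lemma haarE (j : int) (k : nat) (x : R) :
  haar j k x = 2 `^ (j%:~R / 2) *
    (cell_ind (j + 1) k.*2 x + (-1) * cell_ind (j + 1) k.*2.+1 x).
Proof.
rewrite /haar /haar_mother /cell_ind /in_cell; congr (_ * _).
have e1 n : n.+1%:R = n%:R + 1 :> R by rewrite natr1.
rewrite (e1 k.*2.+1) (e1 k.*2) -muln2 natrM.
have b0 := exp2_gt0 R (- (j + 1)).
have jE : (2 : R) ^ j = (2 * 2 ^ (- (j + 1)))^-1 by rewrite -exp2S -invr_expz invrK.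
have jx : 2 ^ j * x = x / (2 * 2 ^ (- (j + 1))) by rewrite jE mulrC.
rewrite jx; move: b0; move: (2 ^ (- (j + 1))) (k%:R : R) => b c b0.
have b20 : 0 < 2 * b by rewrite mulr_gt0.
have -> : (0 < x / (2 * b) - c) = (c * 2 * b < x).
  by rewrite subr_gt0 ltr_pdivlMr// mulrA.
have -> : (x / (2 * b) - c <= 2^-1) = (x <= (c * 2 + 1) * b).
  rewrite lerBlDr ler_pdivrMr//; congr (_ <= _).
  by field.
have -> : (2^-1 < x / (2 * b) - c) = ((c * 2 + 1) * b < x).
  rewrite ltrBrDr ltr_pdivlMr//; congr (_ < _).
  by field.
have -> : (x / (2 * b) - c <= 1) = (x <= (c * 2 + 1 + 1) * b).
  rewrite lerBlDr ler_pdivrMr//; congr (_ <= _).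
  by ring.
have [h|h] := leP x ((c * 2 + 1) * b); rewrite ?andbT ?andbF /=.
  by case: ifP; rewrite ?mulr0 addr0.
by case: ifP => _; rewrite ?mulr1 ?mulr0 add0r.
Qed.

(** The function is constant on the two halves of its interval, which are cells of level j + 1,
    whence the condition on N; the halves have equal measure, whence mean zero. *)
Lemma mean_zero_step_haar (j : int) (k M N : nat) :
  k.+1%:R * 2 ^ (- j) <= 2 ^+ M :> R -> j + 1 <= N%:Z ->
  mean_zero_step M N (@haar R j k).
Proof.
move=> kM jN; rewrite (_ : haar j k = fun x => 2 `^ (j%:~R / 2) *
    (cell_ind (j + 1) k.*2 x + (-1) * cell_ind (j + 1) k.*2.+1 x)); last first.
  by apply/funext => x; exact: haarE.
apply: mean_zero_stepZ.
set f := fun x => _.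
have bf : bounded_measurable f.
  apply: bounded_measurableD; first exact: bounded_measurable_cell.
  exact: bounded_measurableM (bounded_measurable_cst _) (bounded_measurable_cell _ _ _).
have sf x : ~~ in_cell (- M%:Z) 0 x -> f x = 0.
  move=> hx; have : in_cell j k x = false.
    apply/negP => h; move: hx => /negP; apply; have x0 := in_cell_gt0 h.
    move: h => /andP[_ h]; rewrite /in_cell mul0r x0 mul1r opprK.
    exact: le_trans h kM.
  move=> h; have /eqP := in_cell_split j k x.
  rewrite h eq_sym paddr_eq0// => /andP[/eqP h1 /eqP h2].
  by rewrite /f /cell_ind h1 h2 mulr0 addr0.
split=> //.
- move=> i x y hx hy; have x0 := in_cell_gt0 hx; have y0 := in_cell_gt0 hy.
  have e : cell_index (j + 1) x = cell_index (j + 1) y.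
    apply: (same_cell_le x0 y0 jN).
    by move: hx hy; rewrite !in_cellE// => /eqP -> /eqP ->.
  by rewrite /f /cell_ind !in_cellE// e.
- apply: cell_int_eq.
  have h := has_integralD (has_integral_cell R (j + 1) k.*2)
    (has_integralZ (-1) (has_integral_cell R (j + 1) k.*2.+1)).
  rewrite mulN1r subrr in h; apply: has_integral_ext h => x.
  rewrite -/(f x) /cell_ind; case h: (in_cell (- M%:Z) 0 x); first by rewrite mulr1.
  by rewrite sf ?h// mul0r.
Qed.

Lemma haar_span_step (phi : R -> R[i]) : haar_span phi ->
  exists M N, mean_zero_step M N (fun x => complex.Re (phi x)) /\
    mean_zero_step M N (fun x => complex.Im (phi x)).
Proof.
(* Quantifying over all larger M' and N' lets the induction on the list pass to maxima. *)
move=> [l ->]; suff [M [N h]] : exists M N, forall M' N', (M <= M')%N -> (N <= N')%N ->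
    mean_zero_step M' N' (fun x =>
      complex.Re (\sum_(p <- l) p.1 * (haar p.2.1 p.2.2 x)%:C%C)) /\
    mean_zero_step M' N' (fun x =>
      complex.Im (\sum_(p <- l) p.1 * (haar p.2.1 p.2.2 x)%:C%C)).
  by exists M, N; exact: h.
elim: l => [|[c [j k]] l [M [N IH]]].
  exists 0%N, 0%N => M' N' _ _; split.
    by rewrite (_ : (fun x => _) = fun=> 0) ?big_nil; [exact: mean_zero_step0|];
      apply/funext => x; rewrite big_nil.
  by rewrite (_ : (fun x => _) = fun=> 0) ?big_nil; [exact: mean_zero_step0|];
    apply/funext => x; rewrite big_nil.
have [b hb] := exists_exp2_ge (k.+1%:R * 2 ^ (- j) : R).
exists (maxn M b), (maxn N (absz (j + 1)%R)) => M' N'; rewrite !geq_max.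
move=> /andP[MM bM] /andP[NN jN]; have [IH1 IH2] := IH _ _ MM NN.
have hh : mean_zero_step M' N' (@haar R j k).
  apply: mean_zero_step_haar; last by lia.
  by apply: (le_trans hb); rewrite ler_weXn2l// ler1n.
split.
- rewrite (_ : (fun x => _) = fun x => complex.Re c * haar j k x +
      complex.Re (\sum_(p <- l) p.1 * (haar p.2.1 p.2.2 x)%:C%C)).
    exact: mean_zero_stepD (mean_zero_stepZ _ hh) IH1.
  apply/funext => x; rewrite big_cons raddfD /=; congr (_ + _).
  by case: c => a d /=; rewrite mulr0 subr0.
- rewrite (_ : (fun x => _) = fun x => complex.Im c * haar j k x +
      complex.Im (\sum_(p <- l) p.1 * (haar p.2.1 p.2.2 x)%:C%C)).
    exact: mean_zero_stepD (mean_zero_stepZ _ hh) IH2.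
  apply/funext => x; rewrite big_cons raddfD /=; congr (_ + _).
  by case: c => a d /=; rewrite mulr0 add0r.
Qed.

End HaarSpan.

Section Algebra.
Context (R : realType).

(* Both factors satisfy a one-step recursion in K, so that Cauchy-Schwarz for the
   increments of A becomes an induction. *)
Lemma weighted_cauchy_schwarz (a : R) (A : nat -> R) K : 0 < a -> a < 1 ->
  A 0%N = 0 -> (forall i, A i <= A i.+1) ->
  a ^+ K * A K ^+ 2 <= (1 - a) ^+ 2 *
    ((\sum_(i < K) a ^+ i * A i + A K * a ^+ K / (1 - a)) *
     (\sum_(i < K) a ^+ i * (A K - A (K - i.+1)%N) + A K * a ^+ K / (1 - a))).
Proof.
move=> a0 a1 A0 Ale; have a1' : 1 - a != 0 by rewrite subr_eq0 gt_eqF.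
have A_ge0 i : 0 <= A i by elim: i => [|i IH]; [rewrite A0|exact: le_trans IH (Ale i)].
pose h n := (1 - a) * (\sum_(i < n) a ^+ i * A i + A n * a ^+ n / (1 - a)).
pose g n := (1 - a) * (\sum_(i < n) a ^+ i * (A n - A (n - i.+1)%N) + A n * a ^+ n / (1 - a)).
have geom n : (1 - a) * \sum_(i < n) a ^+ i = 1 - a ^+ n.
  elim: n => [|n IH]; first by rewrite big_ord0 mulr0 expr0 subrr.
  by rewrite big_ord_recr /= mulrDr IH exprS; ring.
have hS n : h n.+1 = h n + (A n.+1 - A n) * a ^+ n.+1.
  by rewrite /h big_ord_recr /= exprS; field.
(* Shifting the index by one multiplies the old sum by a and adds the new increment of A to every
   difference; the added terms form a geometric sum. *)
have gS n : g n.+1 = a * g n + (A n.+1 - A n).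
  have e : (1 - a) * (\sum_(i < n.+1) a ^+ i * (A n.+1 - A (n.+1 - i.+1)%N)) =
     (1 - a) * (A n.+1 - A n) + a * ((1 - a) * \sum_(i < n) a ^+ i * (A n - A (n - i.+1)%N))
     + a * (A n.+1 - A n) * (1 - a ^+ n).
    rewrite big_ord_recl expr0 mul1r subSS subn0 mulrDr -addrA; congr (_ + _).
    rewrite -geom [RHS](_ : _ = (1 - a) * (a * (\sum_(i < n) a ^+ i * (A n - A (n - i.+1)%N)
      + (A n.+1 - A n) * \sum_(i < n) a ^+ i))); last by ring.
    congr (_ * _); rewrite mulr_sumr -big_split mulr_sumr; apply: eq_bigr => i _.
    by rewrite /= /bump /= add1n subSS exprS; ring.
  by rewrite /g mulrDr e exprS; field.
have hg0 n : 0 <= h n /\ 0 <= g n.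
  elim: n => [|n [IH1 IH2]].
    by rewrite /h /g !big_ord0 A0 !mul0r add0r !mulr0.
  have d0 : 0 <= A n.+1 - A n by rewrite subr_ge0.
  rewrite hS gS; split; apply: addr_ge0 => //; rewrite mulr_ge0// ?ltW//.
  by rewrite exprn_gt0.
have -> : forall x y, (1 - a) ^+ 2 * (x * y) = ((1 - a) * x) * ((1 - a) * y).
  by move=> x y; ring.
rewrite -/(h K) -/(g K).
elim: K => [|n IH]; first by rewrite /h /g !big_ord0 A0 expr0n !mul0r add0r !mulr0.
have [h0 g0] := hg0 n; have d0 : 0 <= A n.+1 - A n by rewrite subr_ge0.
rewrite hS gS exprS; set d := A n.+1 - A n.
have -> : A n.+1 = A n + d by rewrite /d addrC subrK.
have t0 : 0 < a ^+ n by rewrite exprn_gt0.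
(* Controls the terms linear in d. By the arithmetic-geometric mean inequality the square of the
   right side is at least 4 a^2 a^n h g, and the induction hypothesis bounds h g below by a^n
   A^2. *)
have key : 2 * a * a ^+ n * A n <= h n + g n * a ^+ 2 * a ^+ n.
  have tt : 0 <= a ^+ 2 * a ^+ n by rewrite mulr_ge0 ?exprn_ge0// ltW.
  rewrite -ler_sqr ?nnegrE; last 2 first.
  - by rewrite mulr_ge0// mulr_ge0 ?(ltW t0)// mulr_ge0// ltW.
  - by rewrite addr_ge0// -mulrA mulr_ge0.
  have s := sqr_ge0 (h n - g n * a ^+ 2 * a ^+ n).
  have m := ler_wpM2l tt IH.
  rewrite -subr_ge0 [X in 0 <= X](_ : _ = (h n - g n * a ^+ 2 * a ^+ n) ^+ 2 +
    4 * (a ^+ 2 * a ^+ n * (h n * g n) - a ^+ 2 * a ^+ n * (a ^+ n * A n ^+ 2))); last by ring.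
  by rewrite addr_ge0// mulr_ge0// subr_ge0.
have k1 := ler_wpM2l d0 key; have k2 := ler_wpM2l (ltW a0) IH.
rewrite -/d in k1; move: k1 k2; move: (a ^+ n) (h n) (g n) (A n) d => t x y B d.
rewrite -subr_ge0 => k1; rewrite -subr_ge0 => k2.
rewrite -subr_ge0 [X in 0 <= X](_ : _ =
  (d * (x + y * a ^+ 2 * t) - d * (2 * a * t * B)) +
  (a * (x * y) - a * (t * B ^+ 2))); last by ring.
by rewrite addr_ge0.
Qed.

End Algebra.

(** * Evaluation of both forms *)

Lemma sqr_normc (R : realType) (z : R[i]) :
  ComplexField.Normc.normc z ^+ 2 = complex.Re z ^+ 2 + complex.Im z ^+ 2.
Proof. by case: z => x y /=; rewrite sqr_sqrtr// addr_ge0 ?sqr_ge0. Qed.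

Section FormValues.
Context (R : realType) (M N : nat) (phi : R -> R[i]).
Notation leb := (@lebesgue_measure R).
Notation lebX := (leb \x leb)%E.
Let u x : R := complex.Re (phi x).
Let v x : R := complex.Im (phi x).
Hypotheses (hu : mean_zero_step M N u) (hv : mean_zero_step M N v).
Let K := (M + N)%N.

Definition level_mass n : R := level_inner M n u u + level_inner M n v v.

Let massE : level_mass K = inner M u u + inner M v v.
Proof. by rewrite /level_mass !(@level_inner_fine R M N). Qed.

Lemma sqr_L2norm : L2norm phi ^+ 2 = level_mass K.
Proof.
have h := has_integralD
  (has_integral_cell_int (- M%:Z) 0 (bounded_measurableM (step_bm hu) (step_bm hu)))
  (has_integral_cell_int (- M%:Z) 0 (bounded_measurableM (step_bm hv) (step_bm hv))).
rewrite /L2norm sqr_sqrtr; last by apply: Rintegral_ge0 => x _; rewrite sqr_ge0.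
rewrite massE Rintegral_mkcond.
rewrite (_ : _ \_ _ = fun x => u x * u x * cell_ind (- M%:Z) 0 x +
  v x * v x * cell_ind (- M%:Z) 0 x); first by have [] := h.
apply/funext => x; rewrite patchE /cell_ind sqr_normc -/(u x) -/(v x).
case h0: (in_cell (- M%:Z) 0 x).
  by rewrite mem_set ?mulr1 ?expr2//; exact: in_cell_gt0 h0.
rewrite (step_supp hu) ?h0// (step_supp hv) ?h0// expr0n addr0 !mulr0 addr0.
by case: ifP.
Qed.

Lemma energyE s : 0 < s ->
  energy s phi = (2 - 2 `^ (- (2 * s))) * 2 `^ (- (2 * s)) / 2 `^ (- (2 * s)) ^+ N *
   (\sum_(i < K) 2 `^ (- (2 * s)) ^+ i * (level_mass K - level_mass (K - i.+1)) +
     level_mass K * 2 `^ (- (2 * s)) ^+ K / (1 - 2 `^ (- (2 * s)))).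
Proof.
move=> s0; have q0 : 0 < 2 * s by rewrite mulr_gt0.
have h := has_integralD (has_integral_energy q0 hu) (has_integral_energy q0 hv).
rewrite massE; rewrite -/K in h; set a := 2 `^ (- (2 * s)) in h *.
(* Turns the prefactor 2 (1 - 1/rho) into 2 - a. *)
have rhoE : (2 `^ (1 + 2 * s))^-1 = a / 2 :> R.
  by rewrite -powRN opprD powRD ?pnatr_eq0 ?implybT// powRN powRr1// mulrC.
rewrite rhoE in h.
transitivity ((2 * (1 - a / 2) * a / a ^+ N *
      (\sum_(i < K) a ^+ i * (inner M u u - level_inner M (K - i.+1) u u) +
       inner M u u * a ^+ K / (1 - a)) +
      2 * (1 - a / 2) * a / a ^+ N *
      (\sum_(i < K) a ^+ i * (inner M v v - level_inner M (K - i.+1) v v) +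
       inner M v v * a ^+ K / (1 - a)))); last first.
  rewrite [in RHS](eq_bigr (fun i : 'I_K =>
    a ^+ i * (inner M u u - level_inner M (K - i.+1) u u) +
    a ^+ i * (inner M v v - level_inner M (K - i.+1) v v))) => [|i _]; last first.
    by rewrite /level_mass; ring.
  have -> : 2 * (1 - a / 2) = 2 - a by field.
  by rewrite big_split /=; ring.
rewrite /energy Rintegral_mkcond.
have [_ <-] := h; congr Rintegral; apply/funext => p; rewrite patchE /energy_density.
case: ifPn => [/set_mem [x0 y0]|np].
  rewrite x0 y0 /= sqr_normc !raddfB /= -!/(u _) -!/(v _) powRN.
  by rewrite -mulrDl mulrA.
case: ifPn => [/andP[x0 y0]|_]; last by rewrite addr0.
by move: np; rewrite mem_set.
Qed.

Lemma qformE s : 0 < s -> s < 2^-1 ->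
  qform s phi = ((2 `^ (- (2 * s)) ^+ M)^-1 * (1 - (2 `^ (1 - 2 * s))^-1) *
   (\sum_(i < K) 2 `^ (- (2 * s)) ^+ i * level_mass i +
     level_mass K * 2 `^ (- (2 * s)) ^+ K / (1 - 2 `^ (- (2 * s)))))%:C%C.
Proof.
move=> s0 s1; have r0 : 0 < 1 - 2 * s by rewrite subr_gt0 mulrC -ltr_pdivlMr// mul1r.
have r1 : 1 - 2 * s < 1 by rewrite ltrBlDr ltrDl mulr_gt0.
have aE : 1 - 2 * s - 1 = - (2 * s) by ring.
have bu := step_bm hu; have bv := step_bm hv.
have fine' (f g : R -> R) : mean_zero_step M N f -> mean_zero_step M N g ->
    forall i, (K <= i)%N -> level_inner M i f g = inner M f g.
  by move=> hf hg i; exact: level_inner_fine.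
have pot (f g : R -> R) (hf : mean_zero_step M N f) (hg : mean_zero_step M N g) :=
  has_integral_potential r0 r1 (step_bm hf) (step_bm hg) (fine' _ _ hf hg)
    (level_inner0 g hf).
have sym i : level_inner M i v u = level_inner M i u v.
  by congr (_ * _); apply: eq_bigr => k _; rewrite mulrC.
have symI : inner M v u = inner M u v.
  by rewrite -!(@level_inner_fine R M N _ _ K).
(* Replaces the cut kernel by the true one. On the diagonal they agree because delta is 0 there and
   the inverse of 0 is 0. *)
have potE (f g : R -> R) p : mean_zero_step M N f -> mean_zero_step M N g ->
    potential (1 - 2 * s) M p * (f p.1 * g p.2) =
    if (0 < p.1) && (0 < p.2)
    then dyadic_dist p.1 p.2 `^ (2 * s) * (dyadic_dist p.1 p.2)^-1 * (f p.1 * g p.2) else 0.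
  move=> hf hg; rewrite /potential.
  have -> : 1 - (1 - 2 * s) = 2 * s by ring.
  have [e|ne] := eqVneq p.1 p.2; rewrite /=.
    rewrite mul0r e; case: ifP => // /andP[_ y0].
    by rewrite dyadic_dist_diag// invr0 mulr0 mul0r.
  case h1: (in_cell (- M%:Z) 0 p.1) => /=; last first.
    by rewrite mul0r (step_supp hf) ?h1// mul0r mulr0 if_same.
  case h2: (in_cell (- M%:Z) 0 p.2) => /=; last first.
    by rewrite mul0r (step_supp hg) ?h2// !mulr0 if_same.
  by rewrite (in_cell_gt0 h1) (in_cell_gt0 h2).
rewrite /qform /cintegral2 -complexr0; congr Complex.
- have h := has_integralD (pot _ _ hu hu) (pot _ _ hv hv).
  rewrite massE; rewrite aE in h.
  set a := 2 `^ (- (2 * s)) in h *; set c := 1 - (2 `^ _)^-1 in h *.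
  rewrite Rintegral_mkcond.
  transitivity (a ^- M * c *
    (\sum_(i < K) a ^+ i * level_inner M i u u + inner M u u * a ^+ K / (1 - a)) +
    a ^- M * c *
    (\sum_(i < K) a ^+ i * level_inner M i v v + inner M v v * a ^+ K / (1 - a))); last first.
    rewrite [in RHS](eq_bigr (fun i : 'I_K => a ^+ i * level_inner M i u u +
      a ^+ i * level_inner M i v v)) => [|i _]; last by rewrite /level_mass mulrDr.
    by rewrite big_split /=; ring.
  have [_ <-] := h; congr Rintegral; apply/funext => p; rewrite patchE !potE//.
  case: ifPn => [/set_mem [x0 y0]|np].
    rewrite x0 y0 /= /u /v; case: (phi p.1) => x1 x2; case: (phi p.2) => y1 y2 /=.
    by ring.
  case: ifPn => [/andP[x0 y0]|_]; last by rewrite addr0.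
  by move: np; rewrite mem_set.
(* The imaginary part of phi(x) conj(phi(y)) is v(x) u(y) - u(x) v(y); both terms have the same
   integral by symmetry. *)
- have h := has_integralD (pot _ _ hv hu) (has_integralZ (-1) (pot _ _ hu hv)).
  rewrite symI (eq_bigr (fun i : 'I_K => (2 `^ (1 - 2 * s - 1)) ^+ i * level_inner M i u v)) in h;
    last by move=> i _; rewrite sym.
  rewrite mulN1r subrr in h; rewrite Rintegral_mkcond.
  have [_ <-] := h; congr Rintegral; apply/funext => p; rewrite patchE !potE//.
  case: ifPn => [/set_mem [x0 y0]|np].
    rewrite x0 y0 /= /u /v; case: (phi p.1) => x1 x2; case: (phi p.2) => y1 y2 /=.
    by ring.
  case: ifPn => [/andP[x0 y0]|_]; last by rewrite mulr0 addr0.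
  by move: np; rewrite mem_set.
Qed.

End FormValues.

(** The order of [R[i]] also requires Q(phi) to be real, which [qformE] provides. Q brings 1 -
    1/(2a), the energy brings (2 - a) a, and Cauchy-Schwarz brings (1 - a)^(-2); as a (1 - 1/(2a)) =
    (2a - 1)/2, the product is gamma(s). The factors a^(-M) and a^(-N) cancel against a^(M+N). *)
Theorem theorem2p5 (R : realType) (s : R) (hs0 : 0 < s) (hs1 : s < 2^-1)
    (phi : R -> R[i]) (hphi : haar_span phi) :
  (gamma s * L2norm phi ^+ 4)%:C%C <= qform s phi * (energy s phi)%:C%C.
Proof.
have [M [N [hu hv]]] := haar_span_step hphi.
rewrite (qformE hu hv hs0 hs1) (energyE hu hv hs0) -rmorphM /= lecR.
have -> : L2norm phi ^+ 4 = (L2norm phi ^+ 2) ^+ 2 by rewrite -exprM.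
rewrite (sqr_L2norm hu hv).
rewrite /gamma /gamma1 /gamma2.
have -> : 2 `^ (1 - 2 * s) = 2 * 2 `^ (- (2 * s)) :> R.
  by rewrite powRD ?pnatr_eq0 ?implybT// powRr1.
set a := 2 `^ (- (2 * s)).
have a_gt : 2^-1 < a.
  have -> : 2^-1 = 2 `^ (-1) :> R by rewrite powRN powRr1.
  by apply: ltr_pow2; rewrite ltrN2 mulrC -ltr_pdivlMr// mul1r.
have a_lt : a < 1 by rewrite /a -[X in _ < X](powRr0 2) ltr_pow2// oppr_lt0 mulr_gt0.
have a0 : 0 < a by apply: lt_trans a_gt; rewrite invr_gt0.
have A0 : level_mass M phi 0 = 0.
  by rewrite /level_mass !(@level_inner0 R M N)// addr0.
have Ale i : level_mass M phi i <= level_mass M phi i.+1.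
  by apply: lerD; apply: level_inner_le; [exact: step_bm hu|exact: step_bm hv].
have := weighted_cauchy_schwarz (M + N) a0 a_lt A0 Ale.
set H := (X in (1 - a) ^+ 2 * (X * _)); set G := (X in (1 - a) ^+ 2 * (_ * X)).
set T := level_mass _ _ _ => h; rewrite exprD in h.
have aM : 0 < a ^+ M by rewrite exprn_gt0.
have aN : 0 < a ^+ N by rewrite exprn_gt0.
have c0 : 0 < 1 - a by rewrite subr_gt0.
move: h; rewrite -ler_pdivlMl ?mulr_gt0// => h.
(* This is gamma(s) written in terms of a. *)
have k0 : 0 <= (2 * a - 1) * (2 - a) / (2 * (1 - a) ^+ 2).
  apply: divr_ge0; last by rewrite mulr_ge0 ?sqr_ge0.
  by apply: mulr_ge0; [move: a_gt|move: a_lt]; clear; lra.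
have := ler_wpM2l k0 h.
rewrite [leLHS](_ : _ = 2^-1 * ((2 * a - 1) / (1 - a)) * ((2 - a) / (1 - a)) * T ^+ 2); last first.
  by field; rewrite gt_eqF.
move/le_trans; apply; rewrite le_eqVlt; apply/orP; left; apply/eqP.
transitivity (a ^- M * (1 - (2 * a)^-1) * H * ((2 - a) * a / a ^+ N * G)); last by [].
clear h; move: (a ^+ M) (a ^+ N) aM aN => x y x0 y0.
by field; rewrite !gt_eqF.
Qed.
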